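(* Let $L$ be a finite-dimensional Leibniz algebra over a field. Then $L$ is supersolvable if and only if $L^2$ is nilpotent and $L^*_0(a)=L$ for all $a\in L$.
   Context: A (left) Leibniz algebra over a field $F$ is an $F$-vector space $L$ with a bilinear product $(x,y)\mapsto xy$ such that every left multiplication $L_x: y\mapsto xy$ is a derivation, i.e. $x(yz)=(xy)z+y(xz)$ for all $x,y,z\in L$. All algebras are finite-dimensional. Ideals are two-sided. For subspaces $U,V$ of $L$, $UV$ denotes the span of all products $uv$ with $u\in U$, $v\in V$, and $L^2=LL$. A Leibniz algebra $N$ is nilpotent if the series $N^1=N$, $N^{k+1}=N N^k$ reaches $0$. $L$ is supersolvable if there is a chain $0=I_0\subset I_1\subset\dots\subset I_n=L$ of ideals of $L$ with $\dim I_s=s$ for each $s$. For $a\in L$, let $m(x)=\pi_1(x)^{d_1}\cdots\pi_k(x)^{d_k}$ be the factorization over $F$ of the minimal polynomial of $L_a$ (acting on $L$) into powers of distinct monic irreducible polynomials, ordered so that $\pi_i(x)=x-c_i$ is linear for $i\le s$ and $\pi_i$ is nonlinear for $i>s$. Then $L^*_0(a)=\bigoplus_{i\le s}\ker (L_a-c_iI)^{d_i}$, i.e. the sum of the components in the primary decomposition of $L$ under $L_a$ that belong to the linear factors. *)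

(* Defs.v *)
From HB Require Import structures.
From mathcomp Require Import all_boot all_order all_algebra.
From mathcomp Require Import boolp classical_sets.

Set Implicit Arguments.
Unset Strict Implicit.
Unset Printing Implicit Defensive.

Import GRing.Theory.

Local Open Scope ring_scope.

Section EndoPoly.
Variables (F : fieldType) (L : vectType F).
Implicit Types (f : 'End(L)) (p q m : {poly F}).

Definition lfun_pow f n : 'End(L) := iter n (comp_lfun f) \1%VF.

(* The ring structure on 'End(L) in the library requires L to be nonzero, so
   p(f) is spelled out here: it also covers the zero space. *)
Definition lfun_horner f p : 'End(L) := \sum_(i < size p) p`_i *: lfun_pow f i.

Definition is_minpoly f m : Prop :=
  [/\ m \is monic, lfun_horner f m = 0
    & forall p, lfun_horner f p = 0 -> m %| p].

(* Well defined by lfun_minpolyP and is_minpoly_uniq; on the zero space it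
   is 1. *)
Definition lfun_minpoly f : {poly F} := xget 0 [set m | is_minpoly f m]%classic.

Lemma lfun_horner_widen f p n : (size p <= n)%N ->
  lfun_horner f p = \sum_(i < n) p`_i *: lfun_pow f i.
Proof.
move=> le_pn; rewrite /lfun_horner (big_ord_widen n (fun i => p`_i *: lfun_pow f i)) //.
rewrite big_mkcond; apply: eq_bigr => i _; case: ltnP => // ?.
by rewrite nth_default ?scale0r.
Qed.

Lemma lfun_horner_is_linear f : linear (lfun_horner f).
Proof.
move=> a p q; set n := maxn (size p) (size q).
have le_pn : (size p <= n)%N by rewrite leq_maxl.
have le_qn : (size q <= n)%N by rewrite leq_maxr.
rewrite (lfun_horner_widen f le_pn) (lfun_horner_widen f le_qn).
rewrite (@lfun_horner_widen f (a *: p + q) n); last first.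
  rewrite (leq_trans (size_polyD _ _)) // geq_max le_qn andbT.
  by rewrite (leq_trans (size_scale_leq _ _)).
rewrite scaler_sumr -big_split; apply: eq_bigr => i _.
by rewrite coefD coefZ scalerDl scalerA.
Qed.

HB.instance Definition _ f := GRing.isLinear.Build F {poly F} 'End(L) *:%R
  (lfun_horner f) (lfun_horner_is_linear f).

Lemma lfun_hornerC f c : lfun_horner f c%:P = c *: \1%VF.
Proof.
by rewrite (lfun_horner_widen f (size_polyC_leq1 c)) big_ord1 coefC.
Qed.

Lemma lfun_hornerMX f p : lfun_horner f (p * 'X) = (f \o lfun_horner f p)%VF.
Proof.
rewrite (@lfun_horner_widen f _ (size p).+1); last first.
  by rewrite (leq_trans (size_polyMleq _ _)) // size_polyX addn2.
rewrite big_ord_recl coefMX /= scale0r add0r /lfun_horner.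
elim/big_rec2: _ => [|i y x _ IH]; first by rewrite comp_lfun0r.
by rewrite IH comp_lfunDr coefMX /= comp_lfunZr.
Qed.

Lemma lfun_hornerX f : lfun_horner f 'X = f.
Proof. by rewrite -[X in lfun_horner _ X]mul1r lfun_hornerMX lfun_hornerC scale1r comp_lfun1r. Qed.

Lemma lfun_horner_comm f p : (f \o lfun_horner f p = lfun_horner f p \o f)%VF.
Proof.
elim/poly_ind: p => [|p c IH]; first by rewrite linear0 comp_lfun0r comp_lfun0l.
rewrite linearD /= lfun_hornerMX lfun_hornerC comp_lfunDr comp_lfunDl IH.
by rewrite comp_lfunA IH -comp_lfunZr -comp_lfunZl comp_lfun1l comp_lfun1r.
Qed.

Lemma lfun_hornerM f p q :
  lfun_horner f (p * q) = (lfun_horner f p \o lfun_horner f q)%VF.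
Proof.
elim/poly_ind: q => [|q c IH]; first by rewrite mulr0 linear0 comp_lfun0r.
rewrite mulrDr mulrA !linearD /= !lfun_hornerMX IH comp_lfunDr.
rewrite !comp_lfunA lfun_horner_comm mulrC mul_polyC linearZ /= lfun_hornerC.
by rewrite -comp_lfunZr comp_lfun1r.
Qed.

Lemma lfun_horner_XsubC_exp f c n :
  lfun_horner f (('X - c%:P) ^+ n) = lfun_pow (f - c *: \1)%VF n.
Proof.
elim: n => [|n IH]; first by rewrite expr0 lfun_hornerC scale1r.
rewrite exprS lfun_hornerM IH linearB /= lfun_hornerX lfun_hornerC.
by [].
Qed.

Lemma lfun_horner_annihilator f : exists2 p, p != 0 & lfun_horner f p = 0.
Proof.
set n := \dim {: 'End(L)}.
pose s := [tuple lfun_pow f i | i < n.+1].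
have nfree : ~ free s.
  move=> /eqP fr; have := dimvS (subvf <<s>>%VS).
  by rewrite fr size_tuple ltnn.
apply: contrapT => no; apply: nfree; apply/freeP => k k0 i.
pose p := \poly_(j < n.+1) k (inord j).
have pE (j : 'I_n.+1) : p`_j = k j by rewrite coef_poly ltn_ord inord_val.
have [p0|p0] := eqVneq p 0; first by rewrite -pE p0 coef0.
exfalso; apply: no; exists p => //.
rewrite (@lfun_horner_widen f _ n.+1) ?size_poly // -[RHS]k0.
by apply: eq_bigr => j _; rewrite pE -tnth_nth tnth_mktuple.
Qed.

Lemma lfun_minpolyP f : is_minpoly f (lfun_minpoly f).
Proof.
rewrite /lfun_minpoly; case: xgetP => [m _ //|no_m]; exfalso.
have [q q0 qf] := lfun_horner_annihilator f.
have : exists n, `[< exists p, [/\ p != 0, lfun_horner f p = 0 & size p = n] >].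
  by exists (size q); apply/asboolP; exists q.
move=> ex; case: (ex_minnP ex) => n /asboolP[p [p0 pf szp]] minn.
have lp0 : lead_coef p != 0 by rewrite lead_coef_eq0.
apply: (no_m ((lead_coef p)^-1 *: p)); split.
- by rewrite monicE lead_coefZ mulVf.
- by rewrite linearZ /= pf scaler0.
move=> r rf; rewrite dvdpZl ?invr_eq0 //; apply: contraT => ndv.
suff /minn : `[< exists p0, [/\ p0 != 0, lfun_horner f p0 = 0 &
    size p0 = size (r %% p)] >] by rewrite -szp leqNgt ltn_modp p0.
apply/asboolP; exists (r %% p); split => //.
have := divp_eq r p => /(congr1 (lfun_horner f)).
by rewrite linearD /= lfun_hornerM pf comp_lfun0r add0r rf => <-.
Qed.

Lemma is_minpoly_uniq f m : is_minpoly f m -> m = lfun_minpoly f.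
Proof.
move=> [m1 mf mmin]; have [n1 nf nmin] := lfun_minpolyP f.
by apply/eqP; rewrite -eqp_monic // /eqp mmin // nmin.
Qed.

End EndoPoly.

Section Factorization.
Variable F : fieldType.
Implicit Types (p q : {poly F}) (s : seq ({poly F} * nat)).

Definition is_factorization p s : Prop :=
  [/\ forall pd, pd \in s ->
        [/\ pd.1 \is monic, irreducible_poly pd.1 & (0 < pd.2)%N],
      uniq [seq pd.1 | pd <- s]
    & p = \prod_(pd <- s) pd.1 ^+ pd.2].

(* The chosen factorization is only meaningful for monic p, see
   factorizationP; the order of the factors is not specified. *)
Definition factorization p : seq ({poly F} * nat) :=
  xget [::] [set s | is_factorization p s]%classic.

Lemma factorizationP p : p \is monic -> is_factorization p (factorization p).
Proof.
move=> mp; rewrite /factorization; case: xgetP => [//|no_s]; exfalso.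
have irr_div n q : q \is monic -> (1 < size q)%N -> (size q <= n)%N ->
    exists2 r : {poly F}, r \is monic /\ irreducible_poly r & r %| q.
  elim: n => [|n IH] in q *.
    by move=> _ H; rewrite leqn0 => /eqP E; rewrite E in H.
  move=> mq sq le; have [irr|nirr] := pselect (irreducible_poly q).
    by exists q.
  have [r [sr rq nrq]] : exists r : {poly F}, [/\ size r != 1%N, r %| q & ~~ (r %= q)].
    apply: contrapT => no; apply: nirr; split=> // r sr rq; apply: contraT => nrq.
    by exfalso; apply: no; exists r.
  have q0 : q != 0 by rewrite monic_neq0.
  have r0 : r != 0 by apply: contraNneq q0 => r0; rewrite r0 dvd0p in rq.
  have lr0 : (lead_coef r)^-1 != 0 by rewrite invr_eq0 lead_coef_eq0.
  have [|||t tP tr] := IH ((lead_coef r)^-1 *: r).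
  - by rewrite monicE lead_coefZ mulVf // lead_coef_eq0.
  - rewrite size_scale //; have : (0 < size r)%N by rewrite size_poly_gt0.
    by case: (size r) sr => [|[]].
  - rewrite size_scale // -ltnS (leq_trans _ le) //.
    by rewrite ltn_neqAle dvdp_leq // andbT dvdp_size_eqp.
  by exists t => //; apply: dvdp_trans rq; rewrite dvdpZr in tr.
have [l lP pE] : exists2 l : seq {poly F},
    forall q, q \in l -> q \is monic /\ irreducible_poly q & p = \prod_(q <- l) q.
  have [n] := ubnP (size p); elim: n => // n IH in p mp {no_s} * => le.
  have p0 := monic_neq0 mp.
  have [sp|sp] := leqP (size p) 1%N.
    exists [::]; rewrite ?big_nil //.
    have p1 : size p = 1%N by apply/eqP; rewrite eqn_leq sp size_poly_gt0.
    have /size_poly1P[c _ pc] : size p == 1%N by rewrite p1.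
    by have := mp; rewrite pc monicE lead_coefC => /eqP ->.
  have [r [mr ir] rp] := irr_div _ _ mp sp (leqnn _).
  have E : p = p %/ r * r by rewrite divpK.
  have md : p %/ r \is monic by rewrite -(monicMr _ mr) -E.
  have [|l lP lE] := IH _ md.
    rewrite -ltnS (leq_trans _ le) // ltnS size_divp ?monic_neq0 //.
    have sr : (1 < size r)%N by case: ir.
    by rewrite ltn_subrL -!subn1 subn_gt0 sr (leq_trans _ sp).
  exists (r :: l) => [q|].
    by rewrite inE => /predU1P[-> //|]; exact: lP.
  by rewrite big_cons -lE mulrC.
apply: (no_s [seq (q, count_mem q l) | q <- undup l]); split.
- move=> _ /mapP[q ql ->] /=; rewrite mem_undup in ql.
  have [mq iq] := lP _ ql; split=> //.
  by rewrite -has_count has_pred1.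
- by rewrite -map_comp map_id undup_uniq.
rewrite big_map /= pE -big_undup_iterop_count.
by [].
Qed.

End Factorization.

Section Leibniz.
Variables (F : fieldType) (L : vectType F) (mul : {bilinear L -> L -> L}).
Implicit Types (a x y z : L) (U V W I N : {vspace L}).

Definition left_leibniz : Prop :=
  forall x y z, mul x (mul y z) = mul (mul x y) z + mul y (mul x z).

Definition is_ideal I : Prop :=
  forall x y, y \in I -> mul x y \in I /\ mul y x \in I.

(* Products of basis vectors suffice to span UV, see sub_mulvP. *)
Definition mulv U V : {vspace L} :=
  <<[seq mul u v | u <- vbasis U, v <- vbasis V]>>%VS.

Lemma mem_mulv U V x y : x \in U -> y \in V -> mul x y \in mulv U V.
Proof.
move=> /coord_vbasis -> /coord_vbasis ->; rewrite linear_sumlz.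
apply: memv_suml => i _; rewrite linear_sumr; apply: memv_suml => j _.
rewrite linearZl_LR linearZr_LR; do 2![apply: memvZ].
by apply/memv_span/allpairs_f; apply: mem_nth; rewrite size_tuple.
Qed.

Lemma sub_mulvP U V W :
  reflect (forall x y, x \in U -> y \in V -> mul x y \in W) (mulv U V <= W)%VS.
Proof.
apply: (iffP idP) => [sUVW x y xU yV|H].
  exact: (subvP sUVW) (mem_mulv xU yV).
apply/span_subvP => _ /allpairsP[[u v] /= [uU vV ->]].
by apply: H; apply: vbasis_mem.
Qed.

(* lower_central N k is the term N^(k+1) of the series. *)
Fixpoint lower_central N k : {vspace L} :=
  if k is k'.+1 then mulv N (lower_central N k') else N.

Definition nilpotent N : Prop := exists k, lower_central N k = 0%VS.

Definition supersolvable : Prop :=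
  exists (n : nat) (I : 'I_n.+1 -> {vspace L}),
    [/\ I ord0 = 0%VS, I ord_max = fullv,
        forall s t : 'I_n.+1, (s <= t)%N -> (I s <= I t)%VS,
        forall s, is_ideal (I s)
      & forall s, \dim (I s) = s].

Definition left_mul a : 'End(L) := linfun (mul a).

(* Among monic irreducible polynomials, the linear ones 'X - c%:P are those of
   size 2; lfun_horner_XsubC_exp identifies the corresponding summand with the
   kernel of a power of left_mul a - c *: \1. *)
Definition Lstar0 a : {vspace L} :=
  (\sum_(q <- factorization (lfun_minpoly (left_mul a)) | size q.1 == 2%N)
     lker (lfun_horner (left_mul a) (q.1 ^+ q.2)))%VS.

End Leibniz.

(* Main.v *)
From HB Require Import structures.
Require Import Defs.
From mathcomp Require Import all_boot all_order all_algebra.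
From mathcomp Require boolp.

(** Write N = L^2, and call an endomorphism split when it is annihilated by a
    product of linear polynomials. By primary decomposition, L*_0(a) = L says
    exactly that the left multiplication L_a is split
    ([sum_linear_components_fullP]). The Leibniz identity gives
    L_(xy) = [L_x, L_y], which drives both directions.

    Given a flag of ideals with factors of dimension 1, every L_a acts on each
    factor by a scalar, so L_a is split ([flag_split]). The commutators
    L_(xy) act on the factors by zero, so N maps each term of the flag into the
    previous one and its lower central series reaches 0
    ([flag_derived_nilpotent]).

    Conversely, it is enough to enlarge an arbitrary ideal I <> L to an ideal
    of one more dimension ([ideal_step]). Let W be a subspace stable under left
    multiplications and not contained in I. As N is nilpotent, some vector of W
    outside I is sent into I by all of N; on the subspace of such vectors the
    L_x commute modulo I, and as they are split they have a common eigenvector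
    v in W, modulo I and outside I ([common_eigenvector_left_mul]). It remains
    to control right multiplication by choosing W. The left center
    Z = {z | zL = 0} is stable and contains every xy + yx, because
    L_(xy) + L_(yx) = 0. If Z is not contained in I, take W = Z: then vL = 0.
    Otherwise vx = -xv modulo I for all x, and W = L will do. In both cases
    I + Fv is an ideal. Working modulo I inside L avoids quotient algebras. *)

Local Open Scope ring_scope.

(** * Endomorphisms annihilated by a product of linear polynomials *)

Section SplitEndomorphisms.

Set Implicit Arguments.
Unset Strict Implicit.
Unset Printing Implicit Defensive.

Import GRing.Theory.

Variables (F : fieldType) (V : vectType F).
Implicit Types (f g : 'End(V)) (I W : {vspace V}) (p : {poly F}).

(** The endomorphism [f] is triangularizable: it is annihilated by a product of
    linear polynomials, repetitions being allowed in [rs]. *)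
Definition split_lfun f : Prop :=
  exists rs : seq F, lfun_horner f (\prod_(c <- rs) ('X - c%:P)) = 0.

Lemma lfun_horner_XsubC f c v : lfun_horner f ('X - c%:P) v = f v - c *: v.
Proof.
rewrite linearB /= lfun_hornerX lfun_hornerC.
by rewrite add_lfunE opp_lfunE scale_lfunE id_lfunE.
Qed.

Lemma lfun_horner_prod_cons f c rs v :
  lfun_horner f (\prod_(d <- c :: rs) ('X - d%:P)) v =
  lfun_horner f (\prod_(d <- rs) ('X - d%:P)) (f v - c *: v).
Proof.
by rewrite big_cons mulrC lfun_hornerM comp_lfunE lfun_horner_XsubC.
Qed.

(** An eigenvector modulo [I], without forming the quotient: the factors of an
    annihilating polynomial are applied one by one to a vector outside [I],
    and the last image that is still outside [I] is the eigenvector. *)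
Lemma eigenvector_mod f I W :
    (f @: W <= W)%VS -> split_lfun f -> ~~ (W <= I)%VS ->
  exists c v, [/\ v \in W, v \notin I & f v - c *: v \in I].
Proof.
move=> sfW [rs frs] /subvPn[w wW wI].
have: lfun_horner f (\prod_(c <- rs) ('X - c%:P)) w \in I.
  by rewrite frs zero_lfunE mem0v.
elim: rs {frs} w wW wI => [|c rs IH] w wW wI.
  by rewrite big_nil -polyC1 lfun_hornerC scale1r id_lfunE (negPf wI).
rewrite lfun_horner_prod_cons.
have [wcI _|wcI] := boolP (f w - c *: w \in I); first by exists c, w.
by apply: IH => //; rewrite memvB ?memvZ // (subvP sfW) ?memv_img.
Qed.

Lemma common_eigenvector_mod (fs : seq 'End(V)) I W :
    (forall f, f \in fs ->
       [/\ (f @: I <= I)%VS, (f @: W <= W)%VS & split_lfun f]) ->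
    (forall f g v, f \in fs -> g \in fs -> v \in W ->
       f (g v) - g (f v) \in I) ->
    ~~ (W <= I)%VS ->
  exists v, [/\ v \in W, v \notin I &
    forall f, f \in fs -> exists c, f v - c *: v \in I].
Proof.
elim: fs W => [|f fs IH] W stab comm nWI.
  by have /subvPn[w wW wI] := nWI; exists w.
have [sfI sfW spf] := stab f (mem_head f fs).
have [c [u [uW uI fu]]] := eigenvector_mod sfW spf nWI.
(* The eigenspace of f modulo I inside W is stable under the remaining maps,
   since these commute with f modulo I. *)
pose W' := (W :&: (f - c *: \1) @^-1: I)%VS.
have W'P v : (v \in W') = (v \in W) && (f v - c *: v \in I).
  by rewrite memv_cap -memv_preim add_lfunE opp_lfunE scale_lfunE id_lfunE.
have [||| v [vW' vI vfs]] := IH W'.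
- move=> g gfs; have gffs : g \in f :: fs by rewrite inE gfs orbT.
  have [sgI sgW spg] := stab g gffs; split=> //.
  apply/subvP=> _ /memv_imgP[v + ->]; rewrite !W'P => /andP[vW vI].
  rewrite (subvP sgW) ?memv_img //=.
  have -> : f (g v) - c *: g v = f (g v) - g (f v) + g (f v - c *: v).
    by rewrite [g (_ - _)]linearB /= [g (_ *: _)]linearZ /= addrA subrK.
  rewrite memvD ?comm ?mem_head //.
  by rewrite (subvP sgI) ?memv_img.
- move=> g h v gfs hfs; rewrite W'P => /andP[vW _].
  by apply: comm; rewrite // inE ?gfs ?hfs orbT.
- by apply/subvPn; exists u; rewrite // W'P uW.
move: vW'; rewrite W'P => /andP[vW fv].
exists v; split=> // g; rewrite inE => /predU1P[->|/vfs //].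
by exists c.
Qed.

(** Primary decomposition, in the only direction that is not immediate. *)
Lemma lker_horner_prod_sub f (s : seq ({poly F} * nat)) :
    (forall q, q \in s -> q.1 \is monic /\ irreducible_poly q.1) ->
    uniq [seq q.1 | q <- s] ->
  (lker (lfun_horner f (\prod_(q <- s) q.1 ^+ q.2)) <=
   \sum_(q <- s) lker (lfun_horner f (q.1 ^+ q.2)))%VS.
Proof.
elim: s => [|q s IH] irr /=.
  move=> _; rewrite !big_nil; apply/subvP=> v.
  by rewrite memv_ker -polyC1 lfun_hornerC scale1r id_lfunE memv0.
case/andP=> qs us; rewrite !big_cons; set r := \prod_(i <- s) _.
have irs t : t \in s -> t.1 \is monic /\ irreducible_poly t.1.
  by move=> ts; apply: irr; rewrite inE ts orbT.
have cop : coprimep (q.1 ^+ q.2) r.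
  apply: coprimep_expl; rewrite /r big_seq.
  apply: (big_rec (coprimep q.1)) => [|t p ts]; first exact: coprimep1.
  rewrite coprimepMr => ->; rewrite andbT; apply: coprimep_expr.
  have [mq iq] := irr q (mem_head q s); have [mt it] := irs t ts.
  rewrite irreducible_poly_coprime //; apply: contra qs => qt.
  have : q.1 %= t.1.
    by apply: it; rewrite // neq_ltn; case: iq => ->; rewrite orbT.
  by rewrite eqp_monic // => /eqP ->; apply: map_f.
have {cop} [a [b ab]] : exists a b, a * q.1 ^+ q.2 + b * r = 1.
  case/Bezout_coprimepP: cop => -[a b] /=; set d := _ + _ => d1.
  have l0 : lead_coef d != 0.
    rewrite lead_coef_eq0; apply/negP=> /eqP d0; move: d1.
    by rewrite d0 eqp_sym eqp0 oner_eq0.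
  have /eqpfP := d1; rewrite lead_coef1 divr1 => dE.
  exists ((lead_coef d)^-1 *: a), ((lead_coef d)^-1 *: b).
  rewrite -!scalerAl -scalerDr -/d [in X in _ *: X]dE scalerA.
  by rewrite mulVf // scale1r.
apply/subvP=> v; rewrite memv_ker => /eqP qrv.
have -> : v = lfun_horner f (b * r) v + lfun_horner f (a * q.1 ^+ q.2) v.
  rewrite -add_lfunE -(linearD (lfun_horner f)) /= addrC ab.
  by rewrite -polyC1 lfun_hornerC scale1r id_lfunE.
apply: memv_add.
  rewrite memv_ker -comp_lfunE -lfun_hornerM mulrCA lfun_hornerM comp_lfunE.
  by rewrite qrv linear0.
apply: (subvP (IH irs us)).
rewrite memv_ker -comp_lfunE -lfun_hornerM mulrCA [r * _]mulrC lfun_hornerM.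
by rewrite comp_lfunE qrv linear0.
Qed.

(** The linear primary components fill the space exactly for the
    triangularizable endomorphisms. *)
Lemma sum_linear_components_fullP f :
  (\sum_(q <- factorization (lfun_minpoly f) | size q.1 == 2%N)
     lker (lfun_horner f (q.1 ^+ q.2)))%VS = fullv <-> split_lfun f.
Proof.
have [mm mf mmin] := lfun_minpolyP f.
have [irr us mE] := factorizationP mm.
set s := factorization _ in irr us mE *; split=> [full|[rs frs]].
  pose g := \prod_(q <- s | size q.1 == 2%N) q.1 ^+ q.2.
  have gf : lfun_horner f g = 0.
    apply/lfunP=> v; rewrite zero_lfunE; apply/eqP; rewrite -memv_ker.
    apply: (subvP _ v (memvf v)); rewrite -{}full /g.
    elim: (s) => [|q t IH]; first by rewrite big_nil sub0v.
    rewrite !big_cons; case: ifP => // _; rewrite subv_add; apply/andP; split.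
      apply/subvP=> u; rewrite !memv_ker mulrC lfun_hornerM comp_lfunE.
      by move=> /eqP ->; rewrite linear0.
    apply/(subv_trans IH)/subvP=> u; rewrite !memv_ker lfun_hornerM comp_lfunE.
    by move=> /eqP ->; rewrite linear0.
  suff [rs gE] : exists rs : seq F, g = \prod_(c <- rs) ('X - c%:P).
    by exists rs; rewrite -gE.
  rewrite /g big_seq_cond.
  apply: (big_rec (fun p =>
    exists rs : seq F, p = \prod_(c <- rs) ('X - c%:P)))
    => [|q p /andP[/irr[mq _ _] sq] [rs ->]].
    by exists [::]; rewrite big_nil.
  have [c qE] : exists c, q.1 = 'X - c%:P.
    exists (- q.1`_0); apply/polyP=> i; rewrite coefB coefX coefC.
    case: i => [|[|i]] /=.
    - by rewrite sub0r opprK.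
    - by have /eqP := mq; rewrite lead_coefE (eqP sq) subr0.
    - by rewrite subr0 nth_default // (eqP sq).
  exists (nseq q.2 c ++ rs); rewrite big_cat big_nseq -qE.
  by rewrite -GRing.iter_mulr_1.
have lin q : q \in s -> size q.1 == 2%N.
  move=> qs; have [mq iq d0] := irr q qs.
  have qm : q.1 %| lfun_minpoly f.
    rewrite mE (big_rem q) //= dvdp_mulr // -(prednK d0) exprS.
    exact: dvdp_mulIl.
  have := dvdp_trans qm (mmin _ frs); case: iq => q1 iq.
  elim: rs {frs} => [|c rs IH].
    by rewrite big_nil dvdp1 => /eqP E; rewrite E in q1.
  rewrite big_cons.
  have [qc _|ncop] := boolP (q.1 %| 'X - c%:P).
    have /eqp_size -> : q.1 %= 'X - c%:P.
      by apply: irredp_XsubC; rewrite // neq_ltn q1 orbT.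
    by apply/eqP/size_XsubC.
  by rewrite Gauss_dvdpr // irreducible_poly_coprime.
apply/eqP; rewrite eqEsubv subvf /=.
have -> : fullv = lker (lfun_horner f (lfun_minpoly f)).
  by apply/vspaceP=> v; rewrite memvf mf memv_ker zero_lfunE eqxx.
have -> : (\sum_(q <- s | size q.1 == 2%N) lker (lfun_horner f (q.1 ^+ q.2)) =
    \sum_(q <- s) lker (lfun_horner f (q.1 ^+ q.2)))%VS.
  rewrite big_seq_cond [RHS]big_seq; apply: eq_bigl => q.
  by rewrite andb_idr //; apply: lin.
by rewrite mE; apply: lker_horner_prod_sub => // q /irr[].
Qed.

(** On a factor [W / I] of dimension 1 an endomorphism acts by a scalar. *)
Lemma scalar_on_line f I W : (I <= W)%VS -> \dim W = (\dim I).+1 ->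
    (f @: I <= I)%VS -> (f @: W <= W)%VS ->
  exists c, forall w, w \in W -> f w - c *: w \in I.
Proof.
move=> sIW dW sfI sfW.
have /subvPn[e eW eI] : ~~ (W <= I)%VS.
  by apply/negP=> /dimvS; rewrite dW ltnn.
have WE : (I + <[e]> = W)%VS.
  apply/eqP; rewrite eqEdim subv_add sIW -memvE eW /= dW.
  rewrite ltnNge; apply/negP=> le; move/negP: eI; apply.
  suff /eqP -> : (I == I + <[e]>)%VS.
    by apply: (subvP (addvSr _ _)); rewrite memv_line.
  by rewrite eqEdim addvSl.
have /(subvP sfW) : f e \in (f @: W)%VS by apply: memv_img.
rewrite -WE => /memv_addP[u uI [_ /vlineP[c ->] fe]].
exists c => w /memv_addP[v vI [_ /vlineP[k ->] ->]].
have -> : f (v + k *: e) - c *: (v + k *: e) = f v - c *: v + k *: u.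
  rewrite [f (_ + _)]linearD /= [f (_ *: _)]linearZ /= fe.
  rewrite !scalerDr !scalerA [k * c]mulrC.
  by rewrite opprD addrACA addrK.
by rewrite memvD ?memvB ?memvZ // (subvP sfI) ?memv_img.
Qed.

End SplitEndomorphisms.

(** * Left multiplications of a Leibniz algebra *)

Section LeibnizFlags.

Set Implicit Arguments.
Unset Strict Implicit.
Unset Printing Implicit Defensive.

Import GRing.Theory.

Variables (F : fieldType) (L : vectType F) (mul : {bilinear L -> L -> L}).
Hypothesis leibniz : left_leibniz mul.
Implicit Types (x y z : L) (I N U W : {vspace L}).

Lemma left_mulE x y : left_mul mul x y = mul x y.
Proof. by rewrite lfunE. Qed.

Lemma left_mul_is_linear : linear (left_mul mul).
Proof.
move=> a x y; apply/lfunP=> z.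
by rewrite add_lfunE scale_lfunE !left_mulE linearPl.
Qed.

HB.instance Definition _ := GRing.isLinear.Build F L 'End(L) *:%R
  (left_mul mul) left_mul_is_linear.

(** The elements [z] with [z L = 0]. *)
Definition left_center : {vspace L} := lker (linfun (left_mul mul)).

Lemma left_centerP z : reflect (forall x, mul z x = 0) (z \in left_center).
Proof.
rewrite memv_ker lfunE /=; apply: (iffP eqP) => [z0 x|z0].
  by rewrite -left_mulE z0 zero_lfunE.
by apply/lfunP=> x; rewrite left_mulE z0 zero_lfunE.
Qed.

(** Left multiplication by [x y] is the commutator of those by [x] and [y]. *)
Lemma mul_mulE x y z : mul (mul x y) z = mul x (mul y z) - mul y (mul x z).
Proof. by rewrite leibniz addrK. Qed.

Lemma left_center_stable x z : z \in left_center -> mul x z \in left_center.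
Proof.
move=> /left_centerP z0; apply/left_centerP=> y.
by rewrite mul_mulE !z0 linear0r subr0.
Qed.

Lemma anticommutator_left_center x y : mul x y + mul y x \in left_center.
Proof.
by apply/left_centerP=> z; rewrite linearDl !mul_mulE addrC subrKA subrr.
Qed.

(** The elements [v] with [U v] contained in [I]. *)
Definition transporter U I : {vspace L} :=
  (\bigcap_(i < \dim U) (left_mul mul (vbasis U)`_i @^-1: I))%VS.

Lemma transporterP U I v :
  reflect (forall u, u \in U -> mul u v \in I) (v \in transporter U I).
Proof.
rewrite memvE; apply: (iffP subv_bigcapP) => [UvI u|UvI i _].
  move=> /coord_vbasis ->; rewrite linear_sumlz.
  apply: memv_suml => i _; rewrite linearZl_LR memvZ //.
  by have := UvI i isT; rewrite -memvE -memv_preim left_mulE.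
rewrite -memvE -memv_preim left_mulE; apply: UvI.
by apply: vbasis_mem; rewrite mem_nth // size_tuple.
Qed.

(** * From a flag to the two conditions *)

Section FromFlag.

Variables (n : nat) (J : nat -> {vspace L}).
Hypothesis J0 : J 0 = 0%VS.
Hypothesis Jn : J n = fullv.
Hypothesis Jmono : forall s, (s < n)%N -> (J s <= J s.+1)%VS.
Hypothesis Jideal : forall s, (s <= n)%N -> is_ideal mul (J s).
Hypothesis Jdim : forall s, (s <= n)%N -> \dim (J s) = s.

Lemma flag_scalar x s : (s < n)%N ->
  exists c, forall w, w \in J s.+1 -> mul x w - c *: w \in J s.
Proof.
move=> ltsn; have lesn := ltnW ltsn.
have stab t : (t <= n)%N -> (left_mul mul x @: J t <= J t)%VS.
  move=> letn; apply/subvP=> _ /memv_imgP[v vJ ->]; rewrite left_mulE.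
  by have [] := Jideal letn x vJ.
have dJ : \dim (J s.+1) = (\dim (J s)).+1 by rewrite !Jdim.
have [c cP] := scalar_on_line (Jmono ltsn) dJ (stab _ lesn) (stab _ ltsn).
by exists c => w /cP; rewrite left_mulE.
Qed.

Lemma flag_split x : split_lfun (left_mul mul x).
Proof.
suff [rs rs0] : exists rs : seq F, forall w, w \in J n ->
    lfun_horner (left_mul mul x) (\prod_(c <- rs) ('X - c%:P)) w = 0.
  by exists rs; apply/lfunP=> w; rewrite zero_lfunE rs0 // Jn memvf.
elim: {-2}n (leqnn n) => [_|s IH ltsn].
  by exists [::] => w; rewrite J0 memv0 => /eqP ->; rewrite linear0.
have [rs rs0] := IH (ltnW ltsn); have [c cP] := flag_scalar x ltsn.
exists (c :: rs) => w wJ.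
by rewrite lfun_horner_prod_cons rs0 // left_mulE cP.
Qed.

(** Commutators of left multiplications act as zero on each factor of the
    flag, where left multiplications are scalars. *)
Lemma flag_derived_mul s : (s < n)%N ->
  (mulv mul (mulv mul fullv fullv) (J s.+1) <= J s)%VS.
Proof.
move=> ltsn; apply/sub_mulvP=> a w aN wJ.
suff /subvP/(_ a aN) : (mulv mul fullv fullv <=
    linfun (applyr mul w) @^-1: J s)%VS by rewrite -memv_preim lfunE.
apply/sub_mulvP=> x y _ _; rewrite -memv_preim lfunE /= mul_mulE.
have [c cP] := flag_scalar x ltsn; have [d dP] := flag_scalar y ltsn.
have mulJ z v : v \in J s -> mul z v \in J s.
  by move=> vJ; have [] := Jideal (ltnW ltsn) z vJ.
have [] := (cP w wJ, dP w wJ); set u := _ - c *: w; set v := _ - d *: w => uJ vJ.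
have xw : mul x w = u + c *: w by rewrite subrK.
have yw : mul y w = v + d *: w by rewrite subrK.
have -> : mul x (mul y w) = mul x v + d *: u + (d * c) *: w.
  by rewrite {1}yw linearDr linearZr_LR /= xw scalerDr scalerA addrA.
have -> : mul y (mul x w) = mul y u + c *: v + (d * c) *: w.
  by rewrite {1}xw linearDr linearZr_LR /= yw scalerDr scalerA mulrC addrA.
rewrite opprD addrACA subrr addr0.
by rewrite memvB ?memvD ?memvZ ?mulJ.
Qed.

Lemma flag_derived_nilpotent : nilpotent mul (mulv mul fullv fullv).
Proof.
exists n; set N := mulv _ _ _.
suff H k : (k <= n)%N -> (lower_central mul N k <= J (n - k))%VS.
  by apply/eqP; rewrite -subv0 -J0 -(subnn n) H.
elim: k => [_|k IH ltkn] /=; first by rewrite subn0 Jn subvf.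
apply: (@subv_trans _ _ (mulv mul N (J (n - k)))).
  apply/sub_mulvP=> a w aN wN; apply: mem_mulv => //.
  by apply: (subvP (IH (ltnW ltkn))).
rewrite -[(n - k)%N]prednK ?subn_gt0 // -subnS.
by apply: flag_derived_mul; rewrite ltn_subrL (leq_trans _ ltkn).
Qed.

End FromFlag.

(** * From the two conditions to a flag *)

Section ToFlag.

Hypothesis derived_nilpotent : nilpotent mul (mulv mul fullv fullv).
Hypothesis left_mul_split : forall x, split_lfun (left_mul mul x).

Let N := mulv mul fullv fullv.

Let mul_in_N x y : mul x y \in N.
Proof. by rewrite mem_mulv ?memvf. Qed.

(** Some vector of [W] outside [I] is sent into [I] by all of [N]. Otherwise
    arbitrarily long products [a_1 (a_2 (... (a_k w)))], with the
    [a_i] in [N] and [w] in [W], would stay outside [I], although they lie in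
    ever deeper terms of the lower central series of [N]. *)
Lemma transporter_derived_nontrivial I W :
    (forall x w, w \in W -> mul x w \in W) -> ~~ (W <= I)%VS ->
  ~~ (W :&: transporter N I <= I)%VS.
Proof.
move=> stW /subvPn[w wW wI]; apply/negP=> sub.
have step v : v \in W -> v \notin I -> exists2 a, a \in N & mul a v \notin I.
  move=> vW vI; apply: boolp.contrapT => no; move/negP: vI; apply.
  apply: (subvP sub); rewrite memv_cap vW /=; apply/transporterP=> a aN.
  by apply: contraT => avI; case: no; exists a.
have [k Nk0] := derived_nilpotent.
have [v [_ + vI]] : exists v,
    [/\ v \in W, v \in lower_central mul N k & v \notin I].
  elim: k {Nk0} => [|k [v [vW vN vI]]] /=.
    have [a aN awI] := step w wW wI; exists (mul a w).
    by split=> //; apply: stW.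
  have [a aN avI] := step v vW vI; exists (mul a v).
  by split=> //; [apply: stW | apply: mem_mulv].
by rewrite Nk0 memv0 => /eqP v0; rewrite v0 mem0v in vI.
Qed.

Lemma common_eigenvector_left_mul I W :
    (forall x v, v \in I -> mul x v \in I) ->
    (forall x w, w \in W -> mul x w \in W) -> ~~ (W <= I)%VS ->
  exists v, [/\ v \in W, v \notin I &
    forall x, exists c, mul x v - c *: v \in I].
Proof.
move=> stI stW nWI.
pose W' := (W :&: transporter N I)%VS.
have stW' x w : w \in W' -> mul x w \in W'.
  rewrite !memv_cap => /andP[wW /transporterP wN]; rewrite stW //=.
  apply/transporterP=> a aN.
  rewrite leibniz.
  by apply: memvD; [apply: wN | apply: stI; apply: wN].
have stable U x : (forall x w, w \in U -> mul x w \in U) ->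
    (left_mul mul x @: U <= U)%VS.
  by move=> stU; apply/subvP=> _ /memv_imgP[u uU ->]; rewrite left_mulE stU.
have [||| v [vW' vI vP]] := @common_eigenvector_mod _ _
  [seq left_mul mul x | x <- vbasis {:L}] I W'.
- by move=> _ /mapP[x _ ->]; split; rewrite ?stable.
- move=> _ _ v /mapP[x _ ->] /mapP[y _ ->].
  rewrite memv_cap => /andP[_ /transporterP vN].
  by rewrite !left_mulE -mul_mulE vN.
- exact: transporter_derived_nontrivial.
exists v; split=> // [|x]; first by move: vW'; rewrite memv_cap => /andP[].
(* The eigenvalue is extended linearly from the basis. *)
have /boolp.choice[c cP] (i : 'I_(\dim {:L})) : exists c,
    mul (vbasis {:L})`_i v - c *: v \in I.
  have [|c] := vP (left_mul mul (vbasis {:L})`_i).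
    by apply: map_f; rewrite mem_nth // size_tuple.
  by rewrite left_mulE; exists c.
exists (\sum_i coord (vbasis {:L}) i x * c i).
rewrite {1}(coord_vbasis (memvf x)) linear_sumlz scaler_suml -sumrB.
apply: memv_suml => i _.
by rewrite linearZl_LR -scalerA -scalerBr memvZ.
Qed.

(** If the left center is not contained in [I], the eigenvector can be taken
    there, so that right multiplication kills it; otherwise the product is
    anticommutative modulo [I]. In both cases it spans an ideal modulo [I]. *)
Lemma ideal_step I : is_ideal mul I -> I != fullv ->
  exists J, [/\ is_ideal mul J, (I <= J)%VS & \dim J = (\dim I).+1].
Proof.
move=> idI nI.
have stI x v : v \in I -> mul x v \in I by move=> /(idI x)[].
suff [v [vI vl vr]] : exists v, [/\ v \notin I,
    forall x, exists c, mul x v - c *: v \in I &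
    forall x, exists c, mul v x - c *: v \in I].
  exists (I + <[v]>)%VS; split; last 1 first.
  - rewrite dimv_disjoint_sum ?dim_vline.
      have -> : v != 0 by apply: contraNneq vI => ->; rewrite mem0v.
      by rewrite addn1.
    apply/eqP; rewrite -subv0; apply/subvP=> u /memv_capP[uI /vlineP[k uE]].
    have [k0|k0] := eqVneq k 0; first by rewrite uE k0 scale0r mem0v.
    by case/negP: vI; rewrite -(scalerK k0 v) -uE memvZ.
  - move=> x _ /memv_addP[u uI [_ /vlineP[k ->] ->]].
    have [uxI xuI] := idI x u uI.
    have [c cP] := vl x; have [d dP] := vr x.
    split.
      rewrite linearDr linearZr_LR /= -(subrK (c *: v) (mul x v)) scalerDr addrA.
      by rewrite memv_add ?memvD ?memvZ // memv_line.
    rewrite linearDl linearZl_LR /= -(subrK (d *: v) (mul v x)) scalerDr addrA.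
    by rewrite memv_add ?memvD ?memvZ // memv_line.
  - exact: addvSl.
have [sZI|nZI] := boolP (left_center <= I)%VS; last first.
  have [v [vZ vI vP]] := common_eigenvector_left_mul stI left_center_stable nZI.
  exists v; split=> // x; exists 0.
  by rewrite (left_centerP _ vZ) scale0r subr0 mem0v.
have [||v [_ vI vP]] := @common_eigenvector_left_mul I fullv stI.
- by move=> x w _; apply: memvf.
- by apply: contra nI => fI; rewrite eqEsubv subvf fI.
exists v; split=> // x; have [c cP] := vP x; exists (- c).
have -> : mul v x - (- c) *: v = mul v x + mul x v - (mul x v - c *: v).
  by rewrite scaleNr opprK opprB addrA addrAC addrK.
by rewrite memvB // (subvP sZI) // anticommutator_left_center.
Qed.

(** The flag is obtained by iterating the one-dimensional enlargement from the
    zero ideal. *)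
Lemma supersolvable_of_split : supersolvable mul.
Proof.
have /boolp.choice[next nextP] : forall I, exists J,
    is_ideal mul I -> I != fullv ->
    [/\ is_ideal mul J, (I <= J)%VS & \dim J = (\dim I).+1].
  move=> I; have [[idI nI]|no] := boolp.pselect (is_ideal mul I /\ I != fullv).
    by have [J JP] := ideal_step idI nI; exists J.
  by exists I => idI nI; case: no.
pose J s := iter s next 0%VS.
have JP s : (s <= \dim {:L})%N -> is_ideal mul (J s) /\ \dim (J s) = s.
  elim: s => [_|s IH lts] /=.
    split; last exact: dimv0.
    by move=> x y; rewrite memv0 => /eqP ->; rewrite linear0r linear0l mem0v.
  have [idJ dJ] := IH (ltnW lts).
  have [|? _ ->] := nextP _ idJ; last by rewrite dJ.
  by apply: contraTneq lts => JE; rewrite -dJ JE ltnn.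
have Jmono s t : (s <= t)%N -> (t <= \dim {:L})%N -> (J s <= J t)%VS.
  move=> lest; rewrite -(subnKC lest).
  elim: (t - s)%N => [|k IH]; first by rewrite addn0.
  rewrite addnS => ltL; apply: subv_trans (IH (ltnW ltL)) _.
  have [idJ dJ] := JP _ (ltnW ltL); have [|//] := nextP _ idJ.
  by apply: contraTneq ltL => JE; rewrite -dJ JE ltnn.
exists (\dim {:L}), (fun s => J s); split=> //.
- apply/eqP; rewrite eqEdim subvf /=.
  by have [_ ->] := JP _ (leqnn (\dim {:L})).
- by move=> s t lest; apply: Jmono; rewrite // -ltnS ltn_ord.
- by move=> s; have [|//] := JP s; rewrite -ltnS ltn_ord.
- by move=> s; have [|//] := JP s; rewrite -ltnS ltn_ord.
Qed.

End ToFlag.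

End LeibnizFlags.

Theorem theorem4 (F : fieldType) (L : vectType F)
    (mul : {bilinear L -> L -> L}) (mulP : left_leibniz mul) :
  supersolvable mul <->
  nilpotent mul (mulv mul fullv fullv) /\ (forall a : L, Lstar0 mul a = fullv).
Proof.
split=> [[n [I [I0 In Imono Iid Idim]]]|[Nnil full]].
  pose J s := I (inord s).
  have J0 : J 0%N = 0%VS.
    by rewrite -I0; congr I; apply: val_inj; rewrite /= inordK.
  have Jn : J n = fullv.
    by rewrite -In; congr I; apply: val_inj; rewrite /= inordK.
  have Jmono s : (s < n)%N -> (J s <= J s.+1)%VS.
    by move=> lts; apply: Imono; rewrite !inordK ?leqnSn ?ltnS ?(ltnW lts).
  have Jid s : (s <= n)%N -> is_ideal mul (J s) by move=> _; apply: Iid.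
  have Jdim s : (s <= n)%N -> \dim (J s) = s.
    by move=> les; rewrite Idim inordK.
  split; first exact: (flag_derived_nilpotent mulP J0 Jn Jmono Jid Jdim).
  move=> a; apply/sum_linear_components_fullP.
  exact: (flag_split J0 Jn Jmono Jid Jdim).
apply: supersolvable_of_split => // a.
by apply/sum_linear_components_fullP; apply: full.
Qed.
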